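(* Let $k$ be a field of characteristic zero, let $n\ge 2$ and $m\ge 2$ be integers, let $P(X,Y)=Y^{m}+f_{m-1}(X)Y^{m-1}+\cdots+f_{0}(X)$ with $f_i\in k[X]$, and let $$B_{n,P}=k[X,Y,Z]/\langle X^{n}Z-P(X,Y)\rangle .$$ Let $x,y,z$ be the images of $X,Y,Z$ in $B_{n,P}$ and let $\partial$ be the locally nilpotent $k$-derivation of $B_{n,P}$ given by $\partial(x)=0$, $\partial(y)=x^{n}$, $\partial(z)=\frac{\partial P}{\partial Y}(x,y)$. Then: (1) $\mathrm{ML}(B_{n,P})=k[x]$. Consequently $B_{n,P}$ is semi-rigid. (2) Every $D\in\mathrm{LND}(B_{n,P})$ has the form $D=f(x)\partial$ with $f(x)\in k[x]$.
   Context: For a commutative domain $B$ over a field $k$ of characteristic zero, a $k$-derivation $\partial$ of $B$ is locally nilpotent if for every $a\in B$ there is $N\ge 0$ with $\partial^{N}(a)=0$; $\mathrm{LND}(B)$ is the set of locally nilpotent $k$-derivations of $B$. The Makar-Limanov invariant is $\mathrm{ML}(B)=\bigcap_{D\in\mathrm{LND}(B)}\ker D$. For $\partial\in\mathrm{LND}(B)$, $\deg_\partial(a)=\min\{i\in\mathbb{N}\mid \partial^{i+1}(a)=0\}$ for $a\neq 0$ and $\deg_\partial(0)=-\infty$. $B$ is semi-rigid if all non-zero $\partial\in\mathrm{LND}(B)$ induce the same degree function $\deg_\partial$ (equivalently, the same filtration). *)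

(* Defs.v *)
From HB Require Import structures.
From mathcomp Require Import all_boot all_order all_algebra generic_quotient.
From mathcomp Require Import ring_quotient boolp ring zify.
From mathcomp Require Export mpoly.

Set Implicit Arguments.
Unset Strict Implicit.
Unset Printing Implicit Defensive.

Import GRing.Theory.
Local Open Scope ring_scope.

Section LocallyNilpotent.
Variables (k : fieldType) (A : comAlgType k).

Record LND := MkLND {
  lnd_fun :> {linear A -> A};
  lnd_leibniz : forall a b, lnd_fun (a * b) = a * lnd_fun b + b * lnd_fun a;
  lnd_nilpotent : forall a, exists N, iter N lnd_fun a = 0 }.

Lemma lnd_deg_subproof (D : LND) a : exists i, iter i.+1 D a == 0.
Proof.
by have [N DNa0] := lnd_nilpotent D a; exists N; rewrite iterS DNa0 linear0.
Qed.

(* [None] stands for -oo, the degree of 0. *)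
Definition lnd_deg (D : LND) (a : A) : option nat :=
  if a == 0 then None else Some (ex_minn (lnd_deg_subproof D a)).

Definition lnd_nonzero (D : LND) : Prop := exists a, D a != 0.

Definition makar_limanov (a : A) : Prop := forall D : LND, D a = 0.

Definition semi_rigid : Prop :=
  forall D1 D2 : LND, lnd_nonzero D1 -> lnd_nonzero D2 ->
    forall a, lnd_deg D1 a = lnd_deg D2 a.

End LocallyNilpotent.

Arguments makar_limanov {k A} a.
Arguments semi_rigid {k} A.

Section Surface.
Variables (k : fieldType) (n m : nat) (f : 'I_m -> {poly k}).

Definition varX : {mpoly k[3]} := 'X_(inord 0).
Definition varY : {mpoly k[3]} := 'X_(inord 1).
Definition varZ : {mpoly k[3]} := 'X_(inord 2).

Definition surf_poly : {mpoly k[3]} :=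
  varY ^+ m + \sum_(i < m) horner_alg varX (f i) * varY ^+ i.

Definition surf_eqn : {mpoly k[3]} := varX ^+ n * varZ - surf_poly.

Definition surf_ideal : pred {mpoly k[3]} :=
  fun p => `[< exists q, p = q * surf_eqn >].

Lemma meval_surf_poly (v w : 'I_3 -> k) :
  v (inord 0) = w (inord 0) -> v (inord 1) = w (inord 1) ->
  surf_poly.@[v] = surf_poly.@[w].
Proof.
have hornerE u p : (horner_alg varX p).@[u] = p.[u (inord 0)].
  rewrite /= /horner_morph -horner_map /= -map_poly_comp mevalXU.
  by congr _.[_]; apply: map_poly_id => c _; rewrite /= mevalZ meval1 mulr1.
have YE u : varY.@[u] = u (inord 1) by rewrite mevalXU.
move=> eq0 eq1; rewrite !mevalD !rmorphXn !rmorph_sum /= !YE eq1.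
congr (_ + _); apply: eq_bigr => i _.
by rewrite !mevalM !rmorphXn !hornerE /= !YE eq0 eq1.
Qed.

(* The ideal is proper since its generator vanishes at (1, 0, P(1, 0)). *)
Lemma surf_ideal_closed : idealr_closed surf_ideal.
Proof.
split=> [||a u v /asboolP[q ->] /asboolP[r ->]]; first 2 last.
- by apply/asboolP; exists (a * q + r); rewrite mulrDl mulrA.
- by apply/asboolP; exists 0; rewrite mul0r.
have inordN (i j : nat) : (i < 3)%N -> (j < 3)%N -> i != j ->
    (inord i == inord j :> 'I_3) = false.
  by move=> hi hj; rewrite -val_eqE /= !inordK // => /negbTE.
pose w (j : 'I_3) : k := (j == inord 0)%:R.
pose v j := if j == inord 2 then surf_poly.@[w] else w j.
apply/asboolP => -[q /(congr1 (meval v))/eqP].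
rewrite rmorphM rmorphB rmorphM rmorphXn /= !mevalXU meval1.
rewrite (@meval_surf_poly v w) /v /w ?eqxx ?inordN //.
by rewrite expr1n mul1r subrr mulr0 oner_eq0.
Qed.

HB.instance Definition _ := isIdealr.Build {mpoly k[3]} surf_ideal
  surf_ideal_closed.

Definition surf : Type := {ideal_quot [the idealr _ of surf_ideal]}.
HB.instance Definition _ := GRing.ComNzRing.on surf.

Definition surf_pi (p : {mpoly k[3]}) : surf :=
  \pi_({ideal_quot [the idealr _ of surf_ideal]})%qT p.

Lemma surf_pi_zmod_morphism : zmod_morphism surf_pi.
Proof. exact: pi_is_zmod_morphism. Qed.

Lemma surf_pi_monoid_morphism : monoid_morphism surf_pi.
Proof. exact: pi_is_monoid_morphism. Qed.

HB.instance Definition _ :=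
  GRing.isZmodMorphism.Build _ _ surf_pi surf_pi_zmod_morphism.
HB.instance Definition _ :=
  GRing.isMonoidMorphism.Build _ _ surf_pi surf_pi_monoid_morphism.

Definition surf_scale (c : k) (b : surf) : surf := surf_pi c%:MP * b.

Fact surf_scaleA a b v : surf_scale a (surf_scale b v) = surf_scale (a * b) v.
Proof. by rewrite /surf_scale mulrA -rmorphM -mpolyCM. Qed.

Fact surf_scale1 : left_id 1 surf_scale.
Proof. by move=> b; rewrite /surf_scale mpolyC1 rmorph1 mul1r. Qed.

Fact surf_scaleDr : right_distributive surf_scale +%R.
Proof. by move=> c u v; rewrite /surf_scale mulrDr. Qed.

Fact surf_scaleDl v : {morph surf_scale^~ v : a b / a + b}.
Proof. by move=> a b; rewrite /surf_scale mpolyCD rmorphD mulrDl. Qed.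

HB.instance Definition _ := GRing.Zmodule_isLmodule.Build k surf
  surf_scaleA surf_scale1 surf_scaleDr surf_scaleDl.

Fact surf_scaleAl (c : k) (u v : surf) : c *: (u * v) = (c *: u) * v.
Proof. exact: mulrA. Qed.

HB.instance Definition _ := GRing.Lmodule_isLalgebra.Build k surf surf_scaleAl.
HB.instance Definition _ := GRing.Lalgebra_isComAlgebra.Build k surf.

Fact surf_pi_scalable : scalable surf_pi.
Proof. by move=> c p; rewrite -mul_mpolyC rmorphM. Qed.

HB.instance Definition _ := GRing.isScalable.Build k _ surf *:%R surf_pi
  surf_pi_scalable.

Lemma surf_piP b : exists p, surf_pi p = b.
Proof. by exists (repr b); apply: reprK. Qed.

Lemma surf_pi_eq0 p :
  surf_pi p = 0 <-> exists q, p = q * surf_eqn.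
Proof.
have -> : surf_pi p = 0 <-> p \in surf_ideal; last by split=> /asboolP.
rewrite -[p in p \in _]subr0 (Quotient.idealrBE [the idealr _ of surf_ideal]).
rewrite -(rmorph0 surf_pi); split=> [/eqP//|/eqP//].
Qed.

End Surface.

Section CanonicalDerivation.
Variables (k : fieldType) (n m : nat) (f : 'I_m -> {poly k}).
Local Notation B := (surf n f).
Local Notation pi := (surf_pi n f).
Local Notation F := (surf_eqn n f).
Local Notation X := (varX k).
Local Notation Y := (varY k).
Local Notation Z := (varZ k).

Definition surf_polyY : {mpoly k[3]} := (surf_poly f)^`M(inord 1).

Definition is_surf_del (D : LND B) : Prop :=
  [/\ D (pi X) = 0, D (pi Y) = pi X ^+ n & D (pi Z) = pi surf_polyY].

Lemma mpoly3_ind (Q : {mpoly k[3]} -> Prop) :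
  (forall c, Q c%:MP) -> Q X -> Q Y -> Q Z ->
  (forall p q, Q p -> Q q -> Q (p + q)) ->
  (forall p q, Q p -> Q q -> Q (p * q)) -> forall p, Q p.
Proof.
move=> QC QX QY QZ QD QM p; rewrite (mpolyE p).
apply: big_ind => [||u _]; [by rewrite -mpolyC0 | exact: QD |].
rewrite -mul_mpolyC; apply: (QM) => //; rewrite mpolyXE_id.
apply: big_ind => [||i _]; [by rewrite -mpolyC1 | exact: QM |].
have Qi : Q 'X_i.
  rewrite -[i]inord_val; case: i => -[|[|[|//]]] hi //=.
by elim: (u i) => [|j IHj]; rewrite ?expr0 -?mpolyC1 // exprS; apply: (QM).
Qed.

Lemma surf_poly_ind (Q : {mpoly k[3]} -> Prop) :
  (forall c, Q c%:MP) -> Q X -> Q Y ->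
  (forall p q, Q p -> Q q -> Q (p + q)) ->
  (forall p q, Q p -> Q q -> Q (p * q)) -> Q (surf_poly f).
Proof.
move=> QC QX QY QD QM.
have QE p j : Q p -> Q (p ^+ j).
  by move=> Qp; elim: j => [|j IHj]; rewrite ?expr0 -?mpolyC1 // exprS; apply: (QM).
apply: (QD); first exact: QE.
apply: big_ind => [||i _]; [by rewrite -mpolyC0 | exact: QD |].
apply: (QM); last exact: QE.
rewrite [horner_alg _ _]horner_coef.
apply: big_ind => [||j _]; [by rewrite -mpolyC0 | exact: QD |].
apply: (QM); last exact: QE.
by rewrite coef_map /= -mul_mpolyC mulr1.
Qed.

Let dhat (p : {mpoly k[3]}) : {mpoly k[3]} :=
  X ^+ n * p^`M(inord 1) + surf_polyY * p^`M(inord 2).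

Let dhatD p q : dhat (p + q) = dhat p + dhat q.
Proof. by rewrite /dhat !mderivD; ring. Qed.

Let dhatM p q : dhat (p * q) = p * dhat q + q * dhat p.
Proof. by rewrite /dhat !mderivM; ring. Qed.

Let dhatC c : dhat c%:MP = 0.
Proof. by rewrite /dhat !mderivC !mulr0 addr0. Qed.

Let dvar (i j : nat) : (i < 3)%N -> (j < 3)%N ->
  ('X_(inord i : 'I_3))^`M(inord j) = (i == j)%:R :> {mpoly k[3]}.
Proof.
move=> hi hj; rewrite mderivX mnmE -val_eqE /= !inordK //.
case: eqP => [->|_]; last by rewrite scale0r.
by rewrite scale1r -[X in 'X_[X - _]]add0m addmK mpolyX0.
Qed.

Let dhatX : dhat X = 0.
Proof. by rewrite /dhat !dvar // !mulr0 addr0. Qed.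

Let dhatY : dhat Y = X ^+ n.
Proof. by rewrite /dhat !dvar // mulr1 mulr0 addr0. Qed.

Let dhatZ : dhat Z = surf_polyY.
Proof. by rewrite /dhat !dvar // mulr1 mulr0 add0r. Qed.

Let dhatF : dhat F = 0.
Proof.
have dXn i : (0 < i < 3)%N -> (X ^+ n)^`M(inord i) = 0.
  case/andP=> i_gt0 hi; elim: n => [|j IHj]; first by rewrite expr0 -mpolyC1 mderivC.
  by rewrite exprS mderivM IHj dvar // eq_sym eqn0Ngt i_gt0 mul0r mulr0 addr0.
have PZ : (surf_poly f)^`M(inord 2) = 0.
  apply: (@surf_poly_ind (fun p => p^`M(inord 2) = 0)) => [c|||p q|p q].
  - exact: mderivC.
  - exact: dvar.
  - exact: dvar.
  - by move=> pZ qZ; rewrite mderivD pZ qZ addr0.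
  - by move=> pZ qZ; rewrite mderivM pZ qZ mul0r mulr0 addr0.
rewrite /dhat /surf_eqn !mderivB !mderivM !dXn // !dvar // PZ /surf_polyY /=.
by ring.
Qed.

Let nil p := exists N, iter N dhat p = 0.

Let iter_dhatD N p q : iter N dhat (p + q) = iter N dhat p + iter N dhat q.
Proof. by elim: N => //= N ->; rewrite dhatD. Qed.

Let iter_dhat0 N : iter N dhat 0 = 0.
Proof. by elim: N => //= N ->; rewrite -mpolyC0 dhatC. Qed.

Let nilD p q : nil p -> nil q -> nil (p + q).
Proof.
case=> N pN [M qM]; exists (N + M)%N.
by rewrite iter_dhatD {1}addnC !iterD pN qM !iter_dhat0 addr0.
Qed.

Let nilM p q : nil p -> nil q -> nil (p * q).
Proof.
case=> N pN [M qM]; exists (N + M)%N.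
have [s] : exists s, (N + M = s)%N by exists (N + M)%N.
move=> def_s; rewrite def_s.
elim: s N M def_s p q pN qM => [|s IHs] [|N] [|M] //=.
- by move=> _ p q -> _; rewrite mul0r.
- by move=> _ p q -> _; rewrite mul0r -/(iter s.+1 _ _) iter_dhat0.
- by move=> _ p q _ ->; rewrite mulr0 -/(iter s.+1 _ _) iter_dhat0.
move=> [def_s] p q; rewrite -!iterS !iterSr => pN qM.
rewrite dhatM iter_dhatD (IHs N.+1 M) ?iterSr //; last lia.
by rewrite mulrC (IHs N M.+1) ?iterSr ?addr0 //; lia.
Qed.

Let nil_dhat p : nil (dhat p) -> nil p.
Proof. by case=> N pN; exists N.+1; rewrite iterSr. Qed.

Let nilC c : nil c%:MP. Proof. by exists 1%N; apply: dhatC. Qed.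

Let nilX : nil X. Proof. by exists 1%N; apply: dhatX. Qed.

Let nilY : nil Y.
Proof.
apply: nil_dhat; rewrite dhatY; elim: n => [|j IHj].
  by rewrite expr0 -mpolyC1.
by rewrite exprS; apply: nilM.
Qed.

Let nilZ : nil Z.
Proof.
apply: nil_dhat; rewrite dhatZ.
suff [] : nil (surf_poly f) /\ nil surf_polyY by [].
rewrite /surf_polyY.
apply: (@surf_poly_ind (fun p => nil p /\ nil p^`M(inord 1))) => [c|||p q|p q].
- by rewrite mderivC -mpolyC0.
- by split=> //; rewrite dvar // mulr0n -mpolyC0.
- by split=> //; rewrite dvar // mulr1n -mpolyC1.
- by case=> ? ? [? ?]; rewrite mderivD; split; apply: nilD.
- case=> ? ? [? ?]; rewrite mderivM; split; first exact: nilM.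
  by apply: nilD; apply: nilM.
Qed.

Let nil_all p : nil p.
Proof. exact: mpoly3_ind. Qed.

Let del (b : B) : B := pi (dhat (repr b)).

Let del_pi p : del (pi p) = pi (dhat p).
Proof.
have /surf_pi_eq0[q] : pi (repr (pi p) - p) = 0.
  by rewrite rmorphB -[X in X - _]/(\pi_B (repr (pi p)))%qT reprK subrr.
move/(canRL (subrK _)) => def_p.
have piF : pi F = 0 by apply/surf_pi_eq0; exists 1; rewrite mul1r.
by rewrite /del def_p dhatD dhatM dhatF mulr0 add0r rmorphD rmorphM /= piF mul0r
  add0r.
Qed.

Let del_linear : linear del.
Proof.
move=> c u v; have [p <-] := surf_piP u; have [q <-] := surf_piP v.
rewrite -linearP !del_pi -linearP; congr pi.
by rewrite dhatD -mul_mpolyC dhatM dhatC mulr0 addr0 mul_mpolyC.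
Qed.

Let del_lin : {linear B -> B} :=
  HB.pack del (GRing.isLinear.Build k B B *:%R del del_linear).

Let del_leibniz a b : del (a * b) = a * del b + b * del a.
Proof.
have [p <-] := surf_piP a; have [q <-] := surf_piP b.
by rewrite -rmorphM !del_pi dhatM rmorphD !rmorphM.
Qed.

Let del_nilpotent b : exists N, iter N del b = 0.
Proof.
have [p <-] := surf_piP b; have [N pN] := nil_all p; exists N.
suff -> : iter N del (pi p) = pi (iter N dhat p) by rewrite pN rmorph0.
by elim: N {pN} => //= N ->; rewrite del_pi.
Qed.

Lemma surf_del_exists_unique :
  exists D : LND B, is_surf_del D /\
    forall D' : LND B, is_surf_del D' -> D' =1 D.
Proof.
pose D : LND B := @MkLND k B del_lin del_leibniz del_nilpotent; exists D.
have DP : is_surf_del D.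
  by split; rewrite /= del_pi ?dhatX ?dhatY ?dhatZ ?rmorph0 ?rmorphXn.
split=> // D' [D'X D'Y D'Z] b; have [DX DY DZ] := DP.
have [p <-] := surf_piP b.
have LND1 (E : LND B) : E 1 = 0.
  have := lnd_leibniz E 1 1; rewrite !mul1r => /eqP.
  by rewrite -subr_eq0 opprD addrA subrr sub0r oppr_eq0 => /eqP.
elim/mpoly3_ind: p => [c||||p q Dp Dq|p q Dp Dq].
- have -> : pi c%:MP = c *: 1 by rewrite -[LHS]mulr1.
  by rewrite !linearZ_LR !LND1.
- by rewrite D'X DX.
- by rewrite D'Y DY.
- by rewrite D'Z DZ.
- by rewrite rmorphD !linearD Dp Dq.
- by rewrite rmorphM !lnd_leibniz Dp Dq.
Qed.

End CanonicalDerivation.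

(* Main.v *)
(** B embeds in k(x)[y] with z = x^-n P(x, y), and it is free over k[x] on the
    elements y^(v mod m) z^(v div m), whose leading monomials are
    x^(- n (v div m)) y^v.  Order monomials by their y-degree, then by
    decreasing order in x.  Unless D x = 0 and D y lies in k[x], a locally
    nilpotent D acts on leading monomials with a shift (p, q), q >= 0, and
    x^u y^v is multiplied by an additive weight u al + v be.  Nilpotency forces
    al = - a kap, be = - b kap for kap = p al + q be and naturals a, b with
    m b >= n a, whence p a + q b = -1.  This contradicts the shape of the leading
    monomials of D x and D y as n, m >= 2.  So D is h(x) d/dy, and the y^(m-1)
    coefficient of D z = h x^-n dP/dy shows that x^n divides h. *)

From HB Require Import structures.
Require Import Defs.
From mathcomp Require Import all_boot all_order all_algebra.
From mathcomp Require Import generic_quotient ring zify.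

Set Implicit Arguments.
Unset Strict Implicit.
Unset Printing Implicit Defensive.

Import Order.TTheory GRing.Theory Num.Theory.
Local Open Scope ring_scope.

Lemma lnd1 (k : fieldType) (A : comAlgType k) (D : LND A) : D 1 = 0.
Proof.
have := lnd_leibniz D 1 1; rewrite !mul1r => /eqP.
by rewrite -subr_eq0 opprD addrA subrr sub0r oppr_eq0 => /eqP.
Qed.

(** * Leading terms in k(x)[y]: y-degree first, then the order at x = 0 *)

Section LeadingTerm.
Variable k : fieldType.
Local Notation K := {fraction {poly k}}.
Local Notation "x %:F" := (tofrac x : K).
Local Notation t := ('X : {poly k})%:F.

Lemma fracX_neq0 : t != 0.
Proof. by rewrite tofrac_eq0 polyX_eq0. Qed.

(* [c] may be 0: then the order of [g] at 0 is greater than [u]. *)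
Definition lowest_term (g : K) (u : int) (c : k) :=
  exists2 r : {poly k}, g = t ^ u * r%:F & r.[0] = c.

Lemma exprz_fracX (j : nat) : t ^ j = ('X^j)%:F.
Proof. by rewrite rmorphXn. Qed.

Lemma lowest_term0 u : lowest_term 0 u 0.
Proof. by exists 0; rewrite ?rmorph0 ?mulr0 ?horner0. Qed.

Lemma lowest_term_tofrac (r : {poly k}) : lowest_term r%:F 0 r.[0].
Proof. by exists r; rewrite ?expr0z ?mul1r. Qed.

Lemma lowest_term_fracX u : lowest_term (t ^ u) u 1.
Proof. by exists 1; rewrite ?rmorph1 ?mulr1 ?hornerC. Qed.

Lemma lowest_termD g g' u c c' :
  lowest_term g u c -> lowest_term g' u c' -> lowest_term (g + g') u (c + c').
Proof.
move=> [r -> <-] [r' -> <-]; exists (r + r'); last by rewrite hornerD.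
by rewrite rmorphD mulrDr.
Qed.

Lemma lowest_termM g g' u u' c c' :
  lowest_term g u c -> lowest_term g' u' c' ->
  lowest_term (g * g') (u + u') (c * c').
Proof.
move=> [r -> <-] [r' -> <-]; exists (r * r'); last by rewrite hornerM.
by rewrite rmorphM expfzDr ?fracX_neq0 // mulrACA.
Qed.

(** The excess power of [t] moves into the polynomial factor, which then vanishes at 0. *)
Lemma lowest_term_lt g u u' c :
  lowest_term g u c -> u' < u -> lowest_term g u' 0.
Proof.
move=> [r -> _] lt_u'u.
have [j ->] : exists j : nat, u = u' + j.+1 by exists (`|u - u'|.-1)%N; lia.
exists ('X^(j.+1) * r); last by rewrite hornerM hornerXn expr0n mul0r.
by rewrite rmorphM mulrA expfzDr ?fracX_neq0 // exprz_fracX.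
Qed.

Lemma lowest_term_uniq g u c c' :
  lowest_term g u c -> lowest_term g u c' -> c = c'.
Proof.
move=> [r -> <-] [r' /(mulfI (expfz_neq0 _ fracX_neq0))/eqP].
by rewrite tofrac_eq => /eqP-> <-.
Qed.

(** A nonzero [c] makes [u] the exact order of [g] at 0, while the exponent of any [lowest_term]
    bounds this order from below. *)
Lemma lowest_term_le g u u' c c' : c != 0 ->
  lowest_term g u c -> lowest_term g u' c' -> u' <= u.
Proof.
move=> c_neq0 gc gc'; case: leP => // lt_uu'.
by rewrite (lowest_term_uniq gc (lowest_term_lt gc' lt_uu')) eqxx in c_neq0.
Qed.

Lemma lowest_term_fracX_mul g u u' c :
  lowest_term (t ^ u' * g) (u' + u) c -> lowest_term g u c.
Proof.
have tu_neq0 := expfz_neq0 u' fracX_neq0.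
case=> r; rewrite expfzDr ?fracX_neq0 // -mulrA => /(mulfI tu_neq0) -> <-.
by exists r.
Qed.

(** As for [lowest_term], [c] may be 0: then [e] is zero or its leading monomial is strictly below
    x^u y^v. Sums and products thus need no case distinction. *)
Definition lead_term (e : {poly K}) (u : int) (v : nat) (c : k) :=
  (size e <= v.+1)%N /\ lowest_term e`_v u c.

Lemma coefM_top (e e' : {poly K}) v v' :
  (size e <= v.+1)%N -> (size e' <= v'.+1)%N ->
  (e * e')`_(v + v') = e`_v * e'`_v'.
Proof.
move=> se se'; have lt_v : (v < (v + v').+1)%N by lia.
rewrite coefM (bigD1 (Ordinal lt_v)) //= addKn big1 ?addr0 // => i.
rewrite -val_eqE /= => neq_iv; case: (ltnP v i) => [lt_vi|le_iv].
  by rewrite nth_default ?mul0r // (leq_trans se).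
by rewrite [e'`_ _]nth_default ?mulr0 // (leq_trans se') //; lia.
Qed.

Lemma size_mul_top (e e' : {poly K}) v v' :
  (size e <= v.+1)%N -> (size e' <= v'.+1)%N ->
  (size (e * e')%R <= (v + v').+1)%N.
Proof.
move=> se se'; apply: leq_trans (size_polyMleq _ _) _.
by rewrite -subn1 leq_subLR add1n -addnS -addSn leq_add.
Qed.

Lemma size_exp_top (e : {poly K}) v l :
  (size e <= v.+1)%N -> (size (e ^+ l)%R <= (v * l).+1)%N.
Proof.
move=> se; elim: l => [|l IHl]; first by rewrite expr0 size_poly1.
by rewrite exprS mulnS size_mul_top.
Qed.

Lemma coef_exp_top (e : {poly K}) v l :
  (size e <= v.+1)%N -> (e ^+ l)`_(v * l) = e`_v ^+ l.
Proof.
move=> se; elim: l => [|l IHl]; first by rewrite muln0 coef1.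
by rewrite !exprS mulnS coefM_top ?size_exp_top // IHl.
Qed.

Lemma lead_term0 u v : lead_term 0 u v 0.
Proof. by split; rewrite ?size_poly0 // coef0; apply: lowest_term0. Qed.

Lemma lead_termC g u c : lowest_term g u c -> lead_term g%:P u 0 c.
Proof. by split; rewrite ?size_polyC_leq1 // coefC. Qed.

Lemma lead_termX : lead_term 'X 0 1 1.
Proof.
split; first by rewrite size_polyX.
by rewrite coefX; apply: lowest_term_fracX 0.
Qed.

Lemma lead_termD e e' u v c c' :
  lead_term e u v c -> lead_term e' u v c' -> lead_term (e + e') u v (c + c').
Proof.
move=> [se ec] [se' ec']; split; last by rewrite coefD; apply: lowest_termD.
by rewrite (leq_trans (size_polyD _ _)) // geq_max se.
Qed.

Lemma lead_termM e e' u u' v v' c c' :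
  lead_term e u v c -> lead_term e' u' v' c' ->
  lead_term (e * e') (u + u') (v + v') (c * c').
Proof.
move=> [se ec] [se' ec']; split; first exact: size_mul_top.
by rewrite coefM_top //; apply: lowest_termM.
Qed.

Lemma lead_termN e u v c : lead_term e u v c -> lead_term (- e) u v (- c).
Proof.
case=> se [r er <-]; split; rewrite ?size_polyN // coefN er.
by exists (- r); rewrite ?hornerN // rmorphN mulrN.
Qed.

(** Higher powers of x count as smaller monomials, hence the reversed comparison [u' < u]. *)
Lemma lead_term_lt e u u' v v' c :
  lead_term e u v c -> (v < v')%N || (v == v') && (u' < u) ->
  lead_term e u' v' 0.
Proof.
move=> [se ec] /orP[lt_vv'|/andP[/eqP<- lt_u'u]].
  have le_ev' := leq_trans se lt_vv'.
  by split; rewrite ?nth_default ?(leqW le_ev') //; apply: lowest_term0.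
by split=> //; apply: (lowest_term_lt ec).
Qed.

Lemma lead_term_uniq e u v c c' :
  lead_term e u v c -> lead_term e u v c' -> c = c'.
Proof. by move=> [_ ec] [_]; apply: lowest_term_uniq. Qed.

Lemma lead_term_fracX_mul e u u' v c :
  lead_term ((t ^ u')%:P * e) (u' + u) v c -> lead_term e u v c.
Proof.
have tu_neq0 := expfz_neq0 u' fracX_neq0.
rewrite /lead_term mul_polyC size_scale // coefZ => -[se ec].
by split=> //; apply: lowest_term_fracX_mul ec.
Qed.

(** This chooses the shift in x for the top coefficients of [D x] and [D y], whose exponents must
    differ by one. While [r] and [r'] both vanish at 0, a factor X is moved out of each; this ends
    because one of them is nonzero and loses degree. *)
Lemma lowest_term_pair (g g' : K) (p : int) (r r' : {poly k}) :
  g = t ^ (1 + p) * r%:F -> g' = t ^ p * r'%:F -> (g != 0) || (g' != 0) ->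
  exists p' al be,
    [/\ lowest_term g (1 + p') al, lowest_term g' p' be & ~ (al = 0 /\ be = 0)].
Proof.
have [s] := ubnP (size r + size r')%N; elim: s p r r' => // s IHs.
move=> p r r' le_s gE g'E nz.
have [r0|r_neq0] := eqVneq r.[0] 0; last first.
  exists p, r.[0], r'.[0]; split; [by exists r | by exists r' |].
  by case=> r0; rewrite r0 eqxx in r_neq0.
have [r'0|r'_neq0] := eqVneq r'.[0] 0; last first.
  exists p, r.[0], r'.[0]; split; [by exists r | by exists r' |].
  by case=> _ r'0; rewrite r'0 eqxx in r'_neq0.
have divX (u : {poly k}) : u.[0] = 0 ->
    exists2 w, u = 'X * w & (size w + (u != 0%R) = size u)%N.
  move/eqP/factor_theorem => [w ->]; exists w; first by rewrite subr0 mulrC.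
  rewrite subr0 mulf_eq0 polyX_eq0 orbF.
  by have [->|w_neq0] := eqVneq w 0; rewrite ?mul0r ?size_poly0 // size_mulX ?addn1.
have [w rE sr] := divX r r0; have [w' r'E sr'] := divX r' r'0.
have tS (i : int) : t ^ i * t = t ^ (1 + i).
  by rewrite addrC expfzDr ?fracX_neq0 ?expr1z.
apply: (IHs (1 + p) w w') => //.
- have : (r != 0) || (r' != 0).
    case: eqVneq => //= r_0; apply: contraTneq nz => r'_0.
    by rewrite gE g'E r_0 r'_0 tofrac0 !mulr0 eqxx.
  by move: le_s sr sr'; case: (r != 0); case: (r' != 0) => //=; lia.
- by rewrite gE rE rmorphM mulrA tS.
- by rewrite g'E r'E rmorphM mulrA tS.
Qed.

End LeadingTerm.

(** * The embedding of B into k(x)[y] *)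

Section Embedding.
Variables (k : fieldType) (n m : nat) (f : 'I_m -> {poly k}).
Local Notation K := {fraction {poly k}}.
Local Notation "x %:F" := (tofrac x : K).
Local Notation t := ('X : {poly k})%:F.
Local Notation B := (surf n f).
Local Notation pi := (surf_pi n f).
Local Notation x := (pi (varX k)).
Local Notation y := (pi (varY k)).
Local Notation z := (pi (varZ k)).

Definition coefK (r : {poly k}) : {poly K} := (r%:F)%:P.
HB.instance Definition _ := GRing.RMorphism.copy coefK (polyC \o @tofrac {poly k}).

Definition polyP : {poly K} := 'X ^+ m + \sum_(i < m) coefK (f i) * 'X ^+ i.

Definition embed_var (i : 'I_3) : {poly K} :=
  nth 0 [:: coefK 'X; 'X; (t ^- n)%:P * polyP] i.

Definition mpoly_embed (p : {mpoly k[3]}) : {poly K} :=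
  mmap (coefK \o polyC) embed_var p.
HB.instance Definition _ :=
  GRing.RMorphism.copy mpoly_embed (mmap (coefK \o polyC) embed_var).

Lemma mpoly_embedX : mpoly_embed (varX k) = coefK 'X.
Proof. by rewrite /mpoly_embed mmapX mmap1U /embed_var inordK. Qed.

Lemma mpoly_embedY : mpoly_embed (varY k) = 'X.
Proof. by rewrite /mpoly_embed mmapX mmap1U /embed_var inordK. Qed.

Lemma mpoly_embedZ : mpoly_embed (varZ k) = (t ^- n)%:P * polyP.
Proof. by rewrite /mpoly_embed mmapX mmap1U /embed_var inordK. Qed.

Lemma mpoly_embedC c : mpoly_embed c%:MP = coefK c%:P.
Proof. exact: mmapC. Qed.

Lemma mpoly_embed_horner (r : {poly k}) :
  mpoly_embed (horner_alg (varX k) r) = coefK r.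
Proof.
elim/poly_ind: r => [|r c IHr]; first by rewrite !rmorph0.
rewrite !(rmorphD, rmorphM) /= IHr horner_algX horner_algC mpoly_embedX.
have -> : c *: 1 = c%:MP :> {mpoly k[3]} by rewrite -mul_mpolyC mulr1.
by rewrite mpoly_embedC.
Qed.

Lemma mpoly_embed_surf_eqn : mpoly_embed (surf_eqn n f) = 0.
Proof.
rewrite rmorphB rmorphM rmorphXn /= mpoly_embedX mpoly_embedZ mulrA -rmorphXn.
rewrite -polyCM rmorphXn mulfV ?expf_neq0 ?fracX_neq0 // mul1r.
rewrite rmorphD rmorphXn rmorph_sum /= mpoly_embedY; apply/eqP; rewrite subr_eq0.
apply/eqP; congr (_ + _); apply: eq_bigr => i _.
by rewrite rmorphM rmorphXn /= mpoly_embedY mpoly_embed_horner.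
Qed.

(* Opaque: unification otherwise unfolds [embed] down to the quotient. *)
Fact embed_subproof :
  {e : B -> {poly K} | forall p, e (pi p) = mpoly_embed p}.
Proof.
exists (fun b => mpoly_embed (repr b)) => p.
have /surf_pi_eq0[q /(congr1 mpoly_embed)] : pi (repr (pi p) - p) = 0.
  by rewrite rmorphB -[X in X - _]/(\pi_B (repr (pi p)))%qT reprK subrr.
rewrite rmorphM rmorphB /= mpoly_embed_surf_eqn mulr0 => /eqP.
by rewrite subr_eq0 => /eqP.
Qed.

Definition embed : B -> {poly K} := sval embed_subproof.

Lemma embed_pi p : embed (pi p) = mpoly_embed p.
Proof. exact: (svalP embed_subproof). Qed.

Fact embed_zmod_morphism : zmod_morphism embed.
Proof.
move=> a b; have [p <-] := surf_piP a; have [q <-] := surf_piP b.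
by rewrite -rmorphB !embed_pi rmorphB.
Qed.

Fact embed_monoid_morphism : monoid_morphism embed.
Proof.
split=> [|a b]; first by rewrite -(rmorph1 pi) embed_pi rmorph1.
have [p <-] := surf_piP a; have [q <-] := surf_piP b.
by rewrite -rmorphM !embed_pi rmorphM.
Qed.

HB.instance Definition _ :=
  GRing.isZmodMorphism.Build _ _ embed embed_zmod_morphism.
HB.instance Definition _ :=
  GRing.isMonoidMorphism.Build _ _ embed embed_monoid_morphism.

Definition constx : {poly k} -> B := horner_alg x.
HB.instance Definition _ := GRing.LRMorphism.copy constx (horner_alg x).

Lemma constxX : constx 'X = x. Proof. exact: horner_algX. Qed.

Lemma constxC c : constx c%:P = pi c%:MP.
Proof.
by rewrite /constx horner_algC -(rmorph1 pi) -linearZ -mul_mpolyC mulr1.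
Qed.

Lemma constxE r : constx r = pi (horner_alg (varX k) r).
Proof.
elim/poly_ind: r => [|r c IHr]; first by rewrite !rmorph0.
rewrite !(rmorphD, rmorphM) /= IHr constxX horner_algX /constx !horner_algC.
by rewrite linearZ rmorph1.
Qed.

Lemma embed_constx r : embed (constx r) = coefK r.
Proof. by rewrite constxE embed_pi mpoly_embed_horner. Qed.

Lemma embed_constxM r b : embed (constx r * b) = coefK r * embed b.
Proof. by rewrite (rmorphM embed (constx r) b) /= embed_constx. Qed.

Lemma embedX : embed x = coefK 'X. Proof. by rewrite embed_pi mpoly_embedX. Qed.
Lemma embedY : embed y = 'X. Proof. by rewrite embed_pi mpoly_embedY. Qed.
Lemma embedZ : embed z = (t ^- n)%:P * polyP.
Proof. by rewrite embed_pi mpoly_embedZ. Qed.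

(** * The expansion of elements of B over k[x], indexed by y-degree *)

Lemma surf_relation :
  x ^+ n * z = y ^+ m + \sum_(i < m) constx (f i) * y ^+ i.
Proof.
have /surf_pi_eq0 : exists q, surf_eqn n f = q * surf_eqn n f.
  by exists 1; rewrite mul1r.
rewrite rmorphB rmorphM rmorphXn rmorphD rmorphXn rmorph_sum /= => /eqP.
rewrite subr_eq0 => /eqP->; congr (_ + _); apply: eq_bigr => i _.
by rewrite rmorphM rmorphXn /= constxE.
Qed.

(* Since [P] is monic in [Y], these elements form a basis over [k[x]]. *)
Definition basis_elt (v : nat) : B := y ^+ (v %% m) * z ^+ (v %/ m).

Definition in_span d (b : B) :=
  exists g : nat -> {poly k}, b = \sum_(v < d) constx (g v) * basis_elt v.

Lemma in_span0 d : in_span d 0.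
Proof.
by exists (fun=> 0); rewrite big1 // => v _; rewrite rmorph0 mul0r.
Qed.

Lemma in_spanD d a b : in_span d a -> in_span d b -> in_span d (a + b).
Proof.
case=> g -> [h ->]; exists (fun v => g v + h v); rewrite -big_split /=.
by apply: eq_bigr => v _; rewrite rmorphD mulrDl.
Qed.

Lemma in_spanM d r b : in_span d b -> in_span d (constx r * b).
Proof.
case=> g ->; exists (fun v => r * g v); rewrite mulr_sumr.
by apply: eq_bigr => v _; rewrite rmorphM mulrA.
Qed.

Lemma in_span_basis v d : (v < d)%N -> in_span d (basis_elt v).
Proof.
move=> lt_vd; exists (fun w => (w == v)%:R).
rewrite (bigD1 (Ordinal lt_vd)) //= eqxx rmorph1 mul1r big1 ?addr0 // => w.
by rewrite -val_eqE /= => /negbTE->; rewrite rmorph0 mul0r.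
Qed.

Lemma in_span_sum d (I : finType) (F : I -> B) :
  (forall i, in_span d (F i)) -> in_span d (\sum_i F i).
Proof.
move=> Fd; apply: big_ind => [|a b|i _]; [exact: in_span0|exact: in_spanD|].
exact: Fd.
Qed.

Lemma in_span_leq d d' b : (d <= d')%N -> in_span d b -> in_span d' b.
Proof.
move=> le_dd' [g ->]; apply: in_span_sum => v; apply: in_spanM.
exact: in_span_basis (leq_trans _ le_dd').
Qed.

Hypothesis m_gt0 : (0 < m)%N.

Lemma basis_eltE l j : (j < m)%N -> basis_elt (l * m + j) = y ^+ j * z ^+ l.
Proof.
move=> lt_jm.
by rewrite /basis_elt modnMDl divnMDl // modn_small // divn_small // addn0.
Qed.

Lemma basis_elt_mulz v : z * basis_elt v = basis_elt (v + m).
Proof.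
by rewrite /basis_elt modnDr divnDr ?dvdnn // divnn m_gt0 addn1 exprS mulrCA.
Qed.

(** Only [v] congruent to m - 1 modulo m is not immediate. There y^m is replaced through the surface
    equation: x^n z raises the power of z and has index v + 1, and the terms in f_i have smaller
    index. *)
Lemma in_span_basis_muly v : in_span v.+2 (y * basis_elt v).
Proof.
have [l [j [lt_jm ->]]] : exists l j, (j < m)%N /\ v = (l * m + j)%N.
  by exists (v %/ m)%N, (v %% m)%N; rewrite ltn_pmod -?divn_eq.
rewrite basis_eltE // mulrA -exprS; have [lt_j1m|le_mj1] := ltnP j.+1 m.
  by rewrite -basis_eltE // addnS; apply: in_span_basis.
have -> : j.+1 = m by apply/eqP; rewrite eqn_leq lt_jm.
have -> : y ^+ m = x ^+ n * z - \sum_(i < m) constx (f i) * y ^+ i.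
  by rewrite surf_relation addrK.
rewrite mulrBl -mulrA -exprS -constxX -rmorphXn mulr_suml; apply: in_spanD.
  apply: in_spanM; rewrite -[z ^+ _]mul1r -(expr0 y) -basis_eltE //.
  by apply: in_span_basis; rewrite addn0 mulSn; lia.
rewrite -mulN1r -[-1](rmorphN1 constx); apply: in_spanM.
apply: in_span_sum => i; rewrite -mulrA; apply: in_spanM.
rewrite -basis_eltE //; apply: in_span_basis.
by have := ltn_ord i; lia.
Qed.

Lemma in_span_muly d b : in_span d b -> in_span d.+1 (y * b).
Proof.
case=> g ->; rewrite mulr_sumr; apply: in_span_sum => v.
rewrite mulrCA; apply: in_spanM; apply: in_span_leq (in_span_basis_muly v).
by rewrite ltnS.
Qed.

Lemma in_span_mulz d b : in_span d b -> in_span (d + m) (z * b).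
Proof.
case=> g ->; rewrite mulr_sumr; apply: in_span_sum => v.
rewrite mulrCA; apply: in_spanM; rewrite basis_elt_mulz; apply: in_span_basis.
by rewrite ltn_add2r.
Qed.

Lemma spanned b : exists d, in_span d b.
Proof.
have [p <-] := surf_piP b.
(* Stability of the span under multiplication by [pi p] is the form that passes to products of
   polynomials; the factor [c] = 1 gives the claim. *)
suff : forall d c, in_span d c -> exists d', in_span d' (pi p * c).
  case/(_ 1%N (basis_elt 0) (in_span_basis (ltnSn 0))) => d.
  by rewrite /basis_elt mod0n div0n !mulr1; exists d.
elim/mpoly3_ind: p => [a||||p q IHp IHq|p q IHp IHq] d c dc.
- by exists d; rewrite -constxC; apply: in_spanM.
- by exists d; rewrite -constxX; apply: in_spanM.
- by exists d.+1; apply: in_span_muly.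
- by exists (d + m)%N; apply: in_span_mulz.
- have [d1 d1c] := IHp _ _ dc; have [d2 d2c] := IHq _ _ dc.
  exists (maxn d1 d2); rewrite rmorphD mulrDl; apply: in_spanD.
    by apply: in_span_leq d1c; apply: leq_maxl.
  by apply: in_span_leq d2c; apply: leq_maxr.
- by have [d1 d1c] := IHq _ _ dc; rewrite rmorphM -mulrA; apply: IHp d1c.
Qed.

Lemma size_polyP_low : (size (polyP - 'X^m)%R <= m)%N.
Proof.
rewrite /polyP addrAC subrr add0r; apply: (leq_trans (size_sum _ _ _)).
apply/bigmax_leqP => i _; rewrite mul_polyC (leq_trans (size_scale_leq _ _)) //.
by rewrite size_polyXn.
Qed.

Lemma size_polyP : (size polyP <= m.+1)%N.
Proof.
rewrite -[polyP](subrK 'X^m) (leq_trans (size_polyD _ _)) // geq_max.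
by rewrite size_polyXn leqnn leqW ?size_polyP_low.
Qed.

Lemma coef_polyP : polyP`_m = 1.
Proof.
rewrite -[polyP](subrK 'X^m) coefD coefXn eqxx nth_default ?add0r //.
exact: size_polyP_low.
Qed.

Lemma size_embed_basis v : (size (embed (basis_elt v)) <= v.+1)%N.
Proof.
rewrite rmorphM !rmorphXn /= embedY embedZ exprMn mulrCA -rmorphXn mul_polyC.
rewrite (leq_trans (size_scale_leq _ _)) // [in leqRHS](divn_eq v m) addnC mulnC.
apply: size_mul_top; first by rewrite size_polyXn.
exact: size_exp_top size_polyP.
Qed.

(** The image is y^j (x^-n P)^l with v = l m + j, and P is monic of degree m in y. *)
Lemma coef_embed_basis v :
  (embed (basis_elt v))`_v = t ^ (- (n * (v %/ m))%:Z).
Proof.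
rewrite rmorphM !rmorphXn /= embedY embedZ exprMn mulrCA -rmorphXn mul_polyC.
have def_v : v = (v %% m + m * (v %/ m))%N by rewrite addnC mulnC -divn_eq.
rewrite coefZ [X in _`_X]def_v coefM_top ?size_polyXn //; last first.
  exact: size_exp_top size_polyP.
rewrite coefXn eqxx mul1r coef_exp_top ?size_polyP // coef_polyP expr1n mulr1.
by rewrite exprVn -exprM exprnN.
Qed.

Lemma size_embed_span d b : in_span d b -> (size (embed b) <= d)%N.
Proof.
case=> g ->; rewrite rmorph_sum /= (leq_trans (size_sum _ _ _)) //.
apply/bigmax_leqP => v _; rewrite rmorphM /= embed_constx mul_polyC.
by rewrite (leq_trans (size_scale_leq _ _)) ?(leq_trans (size_embed_basis _)).
Qed.

(** Only the last basis element reaches y-degree d, so its coefficient can be read off the image of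
    [b]. *)
Lemma in_span_split d b : in_span d.+1 b -> exists r b',
  [/\ b = constx r * basis_elt d + b', in_span d b' &
      (embed b)`_d = t ^ (- (n * (d %/ m))%:Z) * r%:F].
Proof.
case=> g ->; rewrite big_ord_recr /= addrC.
set b' := \sum_(_ < d) _; have b'd : in_span d b' by exists g.
exists (g d), b'; split=> //; rewrite rmorphD rmorphM /= embed_constx coefD.
rewrite [X in _ + X]nth_default ?size_embed_span // addr0.
by rewrite mul_polyC coefZ coef_embed_basis mulrC.
Qed.

(** Starting from any expansion, a top index at or above d has coefficient 0, since it would be
    visible in the y-degree; so the expansion can be shortened. *)
Lemma span_size d b : (size (embed b) <= d)%N -> in_span d b.
Proof.
move=> le_bd; have [d' d'b] := spanned b; elim: d' d'b => [|d' IHd'] d'b.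
  exact: in_span_leq d'b.
have [le_d'd|lt_dd'] := leqP d'.+1 d; first exact: in_span_leq d'b.
have [r [b' [def_b b'd']]] := in_span_split d'b.
rewrite nth_default ?(leq_trans le_bd) // => /esym/eqP.
rewrite mulf_eq0 expfz_eq0 (negbTE (fracX_neq0 k)) andbF /= tofrac_eq0 => /eqP r0.
by apply: IHd'; rewrite def_b r0 rmorph0 mul0r add0r.
Qed.

Lemma embed_inj : injective embed.
Proof.
move=> a b eq_ab; apply/eqP; rewrite -subr_eq0; apply/eqP.
(* An element with zero image is spanned by the empty family. *)
have [|g ->] := @span_size 0%N (a - b); last by rewrite big_ord0.
by rewrite rmorphB /= eq_ab subrr size_poly0.
Qed.

Lemma embed_eq0 b : (embed b == 0) = (b == 0).
Proof. by rewrite -(inj_eq embed_inj) rmorph0. Qed.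

Lemma embed_constant b : (size (embed b) <= 1)%N -> exists r, b = constx r.
Proof.
move/span_size => [g ->]; exists (g 0%N).
by rewrite big_ord1 /basis_elt mod0n div0n !mulr1.
Qed.

Lemma lnd_constx (D : LND B) r : D (constx r) = constx r^`() * D x.
Proof.
elim/poly_ind: r => [|r c IHr]; first by rewrite deriv0 !rmorph0 linear0 mul0r.
rewrite derivMXaddC !rmorphD !rmorphM linearD lnd_leibniz IHr /= constxX.
have -> : D (constx c%:P) = 0.
  by rewrite /constx horner_algC linearZ_LR lnd1 scaler0.
by rewrite addr0 mulrDl mulrA [x * _]mulrC.
Qed.

(** * How a locally nilpotent derivation moves leading terms *)

Section Shift.
Variables (D : LND B) (p : int) (q : nat) (al be : k).

Definition weight (u : int) (v : nat) : k := u%:~R * al + v%:R * be.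

(* On the associated graded ring of the lexicographic filtration, [D] induces a
   homogeneous derivation of degree [(p, q)] with eigenvalue [weight u v]. *)
Definition shifts b u v c :=
  lead_term (embed b) u v c /\
  lead_term (embed (D b)) (u + p) (v + q) (c * weight u v).

Lemma shifts0 u v : shifts 0 u v 0.
Proof. by rewrite /shifts linear0 rmorph0 mul0r; split; apply: lead_term0. Qed.

Lemma shiftsD b b' u v c c' :
  shifts b u v c -> shifts b' u v c' -> shifts (b + b') u v (c + c').
Proof.
move=> [bc Dbc] [bc' Dbc']; split; rewrite ?linearD rmorphD ?mulrDl;
  exact: lead_termD.
Qed.

Lemma shifts_sum0 (I : finType) (F : I -> B) u v :
  (forall i, shifts (F i) u v 0) -> shifts (\sum_i F i) u v 0.
Proof.
move=> F0; apply: (big_ind (fun b => shifts b u v 0)) => [|b b' b0 b'0|i _].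
- exact: shifts0.
- by have := shiftsD b0 b'0; rewrite addr0.
- exact: F0.
Qed.

(** The Leibniz rule gives two terms of the same exponents, and their coefficients add up because
    [weight] is additive. *)
Lemma shiftsM b b' u u' v v' c c' : shifts b u v c -> shifts b' u' v' c' ->
  shifts (b * b') (u + u') (v + v') (c * c').
Proof.
move=> [bc Dbc] [bc' Dbc']; split; first by rewrite rmorphM; apply: lead_termM.
rewrite lnd_leibniz rmorphD !rmorphM /=.
have -> : c * c' * weight (u + u') (v + v')
    = c * (c' * weight u' v') + c' * (c * weight u v).
  by rewrite /weight rmorphD natrD /=; ring.
apply: lead_termD; first by rewrite -!addrA -addnA; apply: lead_termM.
by rewrite [u + u']addrC [(v + v')%N]addnC -!addrA -addnA; apply: lead_termM.
Qed.

Lemma shifts_lt b u u' v v' c : shifts b u v c ->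
  (v < v')%N || (v == v') && (u' < u) -> shifts b u' v' 0.
Proof.
move=> [bc Dbc] lt_uv; split; first exact: lead_term_lt bc lt_uv.
rewrite mul0r; apply: lead_term_lt Dbc _.
by rewrite ltn_add2r eqn_add2r ltrD2r.
Qed.

Lemma shiftsXn b u v c l : shifts b u v c -> shifts (b ^+ l) (u *+ l) (v * l) (c ^+ l).
Proof.
move=> bc; elim: l => [|l IHl]; last first.
  by rewrite !exprS mulrS mulnS; apply: shiftsM.
rewrite !expr0 mulr0n muln0; split.
  rewrite rmorph1; apply: lead_termC.
  by exists 1; rewrite ?rmorph1 ?mulr1 ?hornerC.
by rewrite lnd1 rmorph0 /weight !(mul0r, mulr0, addr0); apply: lead_term0.
Qed.

(** As x and y have exponents (1, 0) and (0, 1), these two hypotheses say that [D] moves exponents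
    by (p, q), with weights [al] and [be] that may be 0. *)
Hypothesis Dx : lead_term (embed (D x)) (1 + p) q al.
Hypothesis Dy : lead_term (embed (D y)) p q.+1 be.

Lemma shifts_x : shifts x 1 0 1.
Proof.
split; last by rewrite /weight mul0r addr0 !mul1r.
rewrite embedX; apply: lead_termC; rewrite -['X]expr1.
by rewrite -exprz_fracX; apply: lowest_term_fracX.
Qed.

Lemma shifts_y : shifts y 0 1 1.
Proof.
split; last by rewrite /weight mul0r !add0r !mul1r.
by rewrite embedY; apply: lead_termX.
Qed.

(** The weight of (0, 0) is 0, and the image r' [D x] has order in x at least 1 + p, hence lies
    strictly below x^p y^q. *)
Lemma shifts_constx r : shifts (constx r) 0 0 r.[0].
Proof.
split; first by rewrite embed_constx; apply: lead_termC; apply: lowest_term_tofrac.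
have -> : weight 0 0 = 0 by rewrite /weight !mul0r addr0.
rewrite lnd_constx rmorphM /= embed_constx mulr0 add0r add0n.
apply: (@lead_term_lt _ _ (1 + p) _ q _ (r^`().[0] * al)); last first.
  by rewrite ltnn eqxx /=; lia.
rewrite -[1 + p]add0r -[q]add0n; apply: lead_termM => //.
by apply: lead_termC; apply: lowest_term_tofrac.
Qed.

(** In the surface equation y^m dominates, which settles x^n z. Then x^n [D z] = [D] (x^n z) - z [D]
    (x^n) gives the leading term of [D z] after cancelling x^n in k(x). *)
Lemma shifts_z : shifts z (- n%:Z) m 1.
Proof.
have tn : (t ^ n%:Z)%:P = embed (x ^+ n).
  by rewrite -constxX -(rmorphXn constx) embed_constx exprz_fracX.
have xnz : shifts (x ^+ n * z) 0 m 1.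
  rewrite surf_relation -[1]addr0; apply: shiftsD.
    by have := shiftsXn m shifts_y; rewrite mul0rn mul1n expr1n.
  apply: shifts_sum0 => i.
  apply: shifts_lt (shiftsM (shifts_constx (f i)) (shiftsXn i shifts_y)) _.
  by rewrite add0n mul1n ltn_ord.
have z1 : lead_term (embed z) (- n%:Z) m 1.
  by apply: (@lead_term_fracX_mul _ _ _ n%:Z); rewrite addrN tn -rmorphM; case: xnz.
split=> //; apply: (@lead_term_fracX_mul _ _ _ n%:Z); rewrite tn -rmorphM /=.
have -> : x ^+ n * D z = D (x ^+ n * z) - z * D (x ^+ n).
  by rewrite lnd_leibniz addrK.
rewrite rmorphB rmorphM /=.
have -> : 1 * weight (- n%:Z) m = 1 * weight 0 m - 1 * (1 * weight n 0).
  by rewrite /weight; ring.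
have -> : n%:Z + (- n%:Z + p) = p by rewrite addrA addrN add0r.
apply: lead_termD; first by rewrite -[p]add0r; case: xnz.
apply: lead_termN; have -> : p = - n%:Z + (n%:Z + p) by rewrite addrA addNr add0r.
apply: lead_termM => //; rewrite -[q]add0n.
by have [_] := shiftsXn n shifts_x; rewrite mul0n expr1n natz.
Qed.

Lemma shifts_basis v : shifts (basis_elt v) (- (n * (v %/ m))%:Z) v 1.
Proof.
have := shiftsM (shiftsXn (v %% m) shifts_y) (shiftsXn (v %/ m) shifts_z).
rewrite mul0rn add0r mul1n !expr1n mulr1 [(m * _)%N]mulnC addnC -divn_eq.
by rewrite mulNrn -mulr_natr natz -PoszM.
Qed.

(** In the expansion of [b], indices below v contribute only lower monomials, and the top summand is
    a polynomial in x times a basis element, to which the product rule applies. *)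
Lemma lead_term_shifts b u v c : lead_term (embed b) u v c -> shifts b u v c.
Proof.
move=> bc; have [/span_size/in_span_split[r [b' [def_b [g def_b'] top_b]]] uc] := bc.
have b'0 : shifts b' u v 0.
  rewrite def_b'; apply: shifts_sum0 => i.
  apply: shifts_lt (shiftsM (shifts_constx (g i)) (shifts_basis i)) _.
  by rewrite ltn_ord.
rewrite def_b -[c]addr0; apply: (shiftsD _ b'0); case: uc => r1.
rewrite {}top_b; set w := (n * (v %/ m))%N => eq_r r1c.
(* The coefficient at y^v is both x^-w r and x^u r1. *)
have {}eq_r : r%:F = t ^ (u + w%:Z) * r1%:F.
  rewrite addrC expfzDr ?fracX_neq0 // -mulrA -eq_r mulrA -expfzDr ?fracX_neq0 //.
  by rewrite addrN expr0z mul1r.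
have [le0|lt0] := leP 0 (u + w%:Z).
  have [j def_j] : exists j : nat, u + w%:Z = j by exists `|(u + w%:Z)%R|%N; lia.
  have -> : r = 'X^j * r1.
    apply/eqP; rewrite -(@tofrac_eq {poly k}); apply/eqP.
    by rewrite eq_r def_j exprz_fracX rmorphM.
  have := shiftsM (shiftsM (shiftsXn j shifts_x) (shifts_constx r1)) (shifts_basis v).
  rewrite expr1n mul1r mulr1 mul0n !add0n addr0 natz r1c -constxX.
  rewrite -(rmorphXn constx) -(rmorphM constx) -/w.
  by have -> : j%:Z + - w%:Z = u by lia.
(* Now r1 is divisible by x, so c = 0 and a strict bound on the leading monomial is enough. *)
have [j def_j] : exists j : nat, u + w%:Z = - j.+1%:Z.
  by exists (`|(u + w%:Z)%R|.-1)%N; lia.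
have def_r1 : r1 = 'X^(j.+1) * r.
  apply/eqP; rewrite -(@tofrac_eq {poly k}); apply/eqP.
  rewrite tofracM -exprz_fracX eq_r def_j mulrA -expfzDr ?fracX_neq0 //.
  by rewrite addrN expr0z mul1r.
have -> : c = 0 by rewrite -r1c def_r1 hornerM hornerXn expr0n mul0r.
apply: shifts_lt (shiftsM (shifts_constx r) (shifts_basis v)) _.
by rewrite add0n eqxx ltnn /= add0r -/w; lia.
Qed.

(** Each application of [D] multiplies by the weight of the current exponents, and that weight
    changes by the weight of (p, q) at every step. *)
Lemma lead_term_iter b u v c N : lead_term (embed b) u v c ->
  lead_term (embed (iter N D b)) (u + p *+ N) (v + q * N)
    (c * \prod_(i < N) (weight u v + (p%:~R * al + q%:R * be) *+ i)).
Proof.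
elim: N => [|N IHN] bc; first by rewrite big_ord0 mulr1 addr0 muln0 addn0.
have [_] := lead_term_shifts (IHN bc); rewrite big_ord_recr iterS mulrSr mulnSr.
rewrite !addrA !addnA /= mulrA; congr (lead_term _ _ _ (_ * _)).
by rewrite /weight rmorphD natrD rmorphMn natrM /= -[p%:~R *+ N]mulr_natr
  -[(_ + _) *+ N]mulr_natr; ring.
Qed.

(** Once an iterate of [D] kills [b], the product in [lead_term_iter] is 0, so one of its factors
    is. *)
Lemma lead_term_weight b u v c : c != 0 -> lead_term (embed b) u v c ->
  exists i : nat, weight u v = - ((p%:~R * al + q%:R * be) *+ i).
Proof.
move=> c_neq0 bc; have [N DNb] := lnd_nilpotent D b.
have := lead_term_iter N bc; rewrite DNb rmorph0.
move/lead_term_uniq/(_ (lead_term0 _ _ _))/eqP.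
rewrite mulf_eq0 (negbTE c_neq0) => /prodf_eq0[i _]; rewrite addr_eq0.
by move=> /eqP; exists i.
Qed.

(** The coefficient at y^v is x^(- n (v div m)) times a polynomial in x, which bounds its order from
    below. *)
Lemma lead_term_support b u v c : c != 0 -> lead_term (embed b) u v c ->
  - (n * (v %/ m))%:Z <= u.
Proof.
move=> c_neq0 [/span_size/in_span_split[r [b' [_ _ ->]]] uc].
set w := - _; have := lowest_termM (lowest_term_fracX k w) (lowest_term_tofrac r).
by rewrite addr0; apply: lowest_term_le uc.
Qed.

Hypothesis hk : [pchar k] =i pred0.
Hypothesis hn : (2 <= n)%N.
Hypothesis hm : (2 <= m)%N.

Lemma shift_trivial : al = 0 /\ be = 0.
Proof.
have [[x1 _] [y1 _] [z1 _]] := And3 shifts_x shifts_y shifts_z.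
have [a def_a] := lead_term_weight (oner_neq0 k) x1.
have [b def_b] := lead_term_weight (oner_neq0 k) y1.
have [c def_c] := lead_term_weight (oner_neq0 k) z1.
set kap := p%:~R * al + q%:R * be in def_a def_b def_c.
rewrite /weight mul0r mul1r addr0 in def_a.
rewrite /weight mul0r mul1r add0r in def_b.
have [kap0|kap_neq0] := eqVneq kap 0.
  by rewrite def_a def_b kap0 !mul0rn oppr0.
have natr0 (i : nat) : i%:R = 0 :> k -> i = 0%N.
  by move/eqP; rewrite ((pcharf0P k).1 hk) => /eqP.
have inj_kap (i : int) : kap * i%:~R = 0 -> i = 0.
  move/eqP; rewrite mulf_eq0 (negbTE kap_neq0) /= => /eqP.
  case: i => i; first by rewrite -pmulrn => /natr0->.
  by rewrite NegzE mulrNz -pmulrn => /eqP; rewrite oppr_eq0 => /eqP/natr0.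
have kap_a : kap * a%:R = - al by rewrite def_a opprK mulr_natr.
have kap_b : kap * b%:R = - be by rewrite def_b opprK mulr_natr.
(* Substitute al = - a kap and be = - b kap into the definition of kap, then cancel kap. *)
have ab : p * a + q%:Z * b + 1 = 0.
  apply: inj_kap; rewrite !rmorphD !rmorphM /= -!pmulrn.
  transitivity (p%:~R * (kap * a%:R) + q%:R * (kap * b%:R) + kap); first by ring.
  by rewrite kap_a kap_b /kap; ring.
(* The weight of z is m be - n al = - c kap; so m b - n a = c is nonnegative. *)
have abc : m%:Z * b - n%:Z * a - c%:Z = 0.
  apply: inj_kap; rewrite !rmorphB !rmorphM /= -!pmulrn.
  transitivity (m%:R * (kap * b%:R) - n%:R * (kap * a%:R) - kap *+ c).
    by rewrite -mulr_natr; ring.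
  rewrite kap_a kap_b -[kap *+ c]opprK -def_c /weight; ring.
have [a0|a_gt0] := posnP a; first by move: ab; rewrite a0; nia.
have b_gt0 : (0 < b)%N by nia.
have al_neq0 : al != 0.
  apply/eqP => al0; move/eqP: kap_a; rewrite al0 oppr0 mulf_eq0.
  by rewrite (negbTE kap_neq0) => /eqP/natr0; lia.
have be_neq0 : be != 0.
  apply/eqP => be0; move/eqP: kap_b; rewrite be0 oppr0 mulf_eq0.
  by rewrite (negbTE kap_neq0) => /eqP/natr0; lia.
have := lead_term_support al_neq0 Dx; have := lead_term_support be_neq0 Dy.
have [s [r [lt_rm def_q]]] : exists s r, (r < m)%N /\ q = (s * m + r)%N.
  by exists (q %/ m)%N, (q %% m)%N; rewrite ltn_pmod -?divn_eq.
have -> : (q %/ m)%N = s by rewrite def_q divnMDl // divn_small // addn0.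
(* If r + 1 < m, the support bound for [D y] is p >= - n s. With n a <= m b it gives p a >= - s m b,
   hence p a + q b >= 0, against [ab]. *)
have [lt_r1m|le_mr1] := ltnP r.+1 m.
  have -> : (q.+1 %/ m)%N = s by rewrite def_q -addnS divnMDl // divn_small // addn0.
  move=> ple _; have : - (n * s)%:Z * a <= p * a by rewrite ler_wpM2r.
  by rewrite def_q in ab; nia.
(* If r = m - 1, the bound for [D x] only gives p a + q b >= r b - a. This is still nonnegative: a
   <= (m - 1) b follows from n a <= m b and n, m >= 2. *)
move=> _ ple; have : - (n * s)%:Z * a <= (1 + p) * a by rewrite ler_wpM2r.
have : (a <= r * b)%N by nia.
by rewrite def_q in ab; nia.
Qed.

End Shift.

(** * Locally nilpotent derivations of B as multiples of d/dy *)

Section CharacteristicZero.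
Hypothesis hk : [pchar k] =i pred0.
Hypothesis hn : (2 <= n)%N.
Hypothesis hm : (2 <= m)%N.

(** If one of the two top coefficients were nonzero, [lowest_term_pair] would provide a shift with
    [al] and [be] not both 0, which [shift_trivial] excludes. *)
Lemma lnd_bound_descent (D : LND B) q :
  (size (embed (D x)) <= q.+1)%N -> (size (embed (D y)) <= q.+2)%N ->
  (size (embed (D x)) <= q)%N /\ (size (embed (D y)) <= q.+1)%N.
Proof.
move=> sx sy.
have [r [_ [_ _ rE]]] := in_span_split (span_size sx).
have [r' [_ [_ _ r'E]]] := in_span_split (span_size sy).
have [nz|] := boolP (((embed (D x))`_q != 0) || ((embed (D y))`_q.+1 != 0)); last first.
  move=> /norP[/negPn/eqP x0 /negPn/eqP y0].
  have drop (e : {poly K}) d : (size e <= d.+1)%N -> e`_d = 0 -> (size e <= d)%N.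
    move=> se e0; apply/leq_sizeP => j; rewrite leq_eqVlt.
    by case/predU1P=> [<-//|/(leq_sizeP _ _ se)].
  by split; apply: drop.
set w := (n * (q %/ m))%N in rE; set w' := (n * (q.+1 %/ m))%N in r'E.
(* The top coefficients are x^-w r and x^-w' r'. The starting exponent - (1 + w + w') is low enough
   to write both with polynomial factors and x-exponents differing by one. *)
have [||p [al [be [xal ybe]]]] := @lowest_term_pair _ _ _
  (- (1 + w + w')%N%:Z) ('X^w' * r) ('X^(w.+1) * r') _ _ nz.
- rewrite rE tofracM -exprz_fracX mulrA -expfzDr ?fracX_neq0 //.
  by congr (t ^ _ * _); lia.
- rewrite r'E tofracM -exprz_fracX mulrA -expfzDr ?fracX_neq0 //.
  by congr (t ^ _ * _); lia.
by case; apply: (@shift_trivial D p q).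
Qed.

Lemma lnd_kernel (D : LND B) : D x = 0 /\ exists h, D y = constx h.
Proof.
suff [Dx0 /embed_constant] : (size (embed (D x)) <= 0)%N /\ (size (embed (D y)) <= 1)%N.
  by split=> //; apply/eqP; rewrite -embed_eq0 -size_poly_leq0.
pose q := maxn (size (embed (D x))) (size (embed (D y))).
have : (size (embed (D x)) <= q)%N /\ (size (embed (D y)) <= q.+1)%N.
  by split; [exact: leq_maxl | exact/leqW/leq_maxr].
elim: q => [[]|q IHq [sx sy]]; first by [].
exact: IHq (lnd_bound_descent sx sy).
Qed.

(** Both sides are derivations along [embed] that agree on x and y. They agree on z because they
    agree on x^n z and both kill x^n. *)
Lemma embed_lnd (D : LND B) h b : D x = 0 -> D y = constx h ->
  embed (D b) = coefK h * (embed b)^`().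
Proof.
move=> Dx0 Dy; pose T a := embed (D a) = coefK h * (embed a)^`().
have TD a a' : T a -> T a' -> T (a + a').
  by rewrite /T => Ta Ta'; rewrite linearD !rmorphD /= Ta Ta' derivD mulrDr.
have TM a a' : T a -> T a' -> T (a * a').
  rewrite /T => Ta Ta'; rewrite lnd_leibniz rmorphD !rmorphM /= Ta Ta' derivM.
  move: (coefK h) (embed a) (embed a') => e u u'.
  rewrite (mulrCA u) (mulrCA u') -mulrDr addrC [u' * _]mulrC; reflexivity.
have Tc r : T (constx r).
  by rewrite /T lnd_constx Dx0 mulr0 rmorph0 embed_constx derivC mulr0.
have Ty : T y by rewrite /T Dy embed_constx embedY derivX mulr1.
have TX a j : T a -> T (a ^+ j).
  move=> Ta; elim: j => [|j IHj]; last first.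
    by rewrite exprS; exact: TM Ta IHj.
  by rewrite expr0 -(rmorph1 constx); exact: Tc.
have Txnz : T (x ^+ n * z).
  rewrite surf_relation; apply: (TD); first exact: TX Ty.
  apply: (big_ind T) => [||i _]; [|exact: TD|exact: TM (Tc _) (TX _ _ Ty)].
  by rewrite -(rmorph0 constx); exact: Tc.
have Tcancel a c : D a = 0 -> (embed a)^`() = 0 -> embed a != 0 ->
    T (a * c) -> T c.
  rewrite /T lnd_leibniz => -> da a_neq0; rewrite mulr0 addr0.
  rewrite (rmorphM embed a (D c)) (rmorphM embed a c) /= derivM {}da.
  move: (coefK h) (embed a) (embed c) (embed (D c)) a_neq0 => w e u v e_neq0.
  by rewrite mul0r add0r mulrCA => /(mulfI e_neq0).
have Tz : T z.
  apply: (Tcancel (constx 'X^n)); last by rewrite (rmorphXn constx) /= constxX.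
  - by rewrite lnd_constx Dx0 mulr0.
  - by rewrite embed_constx derivC.
  - by rewrite embed_constx polyC_eq0 tofrac_eq0 expf_neq0 ?polyX_eq0.
rewrite -/(T b); have [p <-] := surf_piP b.
elim/mpoly3_ind: p => [c||||p p' Tp Tp'|p p' Tp Tp'].
- by rewrite -constxC; exact: Tc.
- by rewrite -constxX; exact: Tc.
- exact: Ty.
- exact: Tz.
- by rewrite rmorphD; exact: TD.
- by rewrite rmorphM; exact: TM.
Qed.

Lemma natr_neq0 i : i.+1%:R != 0 :> k.
Proof. by rewrite ((pcharf0P k).1 hk). Qed.

Lemma embed_lnd_ex (D : LND B) :
  exists r, forall b, embed (D b) = coefK ('X^n * r) * (embed b)^`().
Proof.
have [Dx0 [h Dy]] := lnd_kernel D; have embedD b := embed_lnd b Dx0 Dy.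
have zE : z = basis_elt m.
  by rewrite /basis_elt modnn divnn m_gt0 expr0 expr1 mul1r.
have mE : m = m.-1.+1 by rewrite prednK.
have sz : (size (embed (D z)) <= m.-1.+1)%N.
  apply/leq_sizeP => j; rewrite -mE => le_mj; rewrite embedD coefCM coef_deriv zE.
  by rewrite nth_default ?mul0rn ?mulr0 // (leq_trans (size_embed_basis _)).
have [r [_ [_ _ top]]] := in_span_split (span_size sz).
(* Below index m the basis elements are powers of y, so the y^(m-1) coefficient of [D z] is a
   polynomial in x; it also equals m h x^-n. *)
have low : t ^ (- (n * (m.-1 %/ m))%:Z) = 1.
  by rewrite divn_small ?muln0 ?oppr0 ?expr0z // [ltnRHS]mE.
have hr : h%:F * (t ^ (- n%:Z) *+ m) = r%:F.
  rewrite -[RHS]mul1r -low -top embedD coefCM coef_deriv -mE zE.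
  by rewrite coef_embed_basis divnn m_gt0 muln1.
have tn : t ^+ n * t ^ (- n%:Z) = 1.
  by rewrite -exprnN mulfV ?expf_neq0 ?fracX_neq0.
have hE : 'X^n * r = h *+ m.
  apply/eqP; rewrite -(@tofrac_eq {poly k}); apply/eqP.
  by rewrite tofracM -hr tofracMn tofracXn mulrCA mulrnAr tn mulr_natr.
have m_neq0 : m%:R != 0 :> k by rewrite mE natr_neq0.
(* Since m is invertible in k, x^n divides h itself. *)
have rE : 'X^n * (m%:R^-1 *: r) = h.
  by rewrite -scalerAr hE -scaler_nat scalerA mulVf // scale1r.
by exists (m%:R^-1 *: r) => b; rewrite rE; apply: embedD.
Qed.

Lemma deriv_eq0 (e : {poly K}) : e^`() = 0 -> (size e <= 1)%N.
Proof.
move=> e0; apply/leq_sizeP => -[//|j] _; have := coef_deriv e j.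
rewrite e0 coef0 -mulr_natr => /esym/eqP; rewrite mulf_eq0 => /orP[/eqP//|].
have -> : j.+1%:R = (j.+1%:R : k)%:P%:F :> K by rewrite !rmorph_nat.
by rewrite tofrac_eq0 polyC_eq0 (negbTE (natr_neq0 j)).
Qed.

End CharacteristicZero.
End Embedding.

(** * The invariant, semi-rigidity and the form of all derivations *)

Theorem proposition4p1 (k : fieldType) (hk : [pchar k] =i pred0)
    (n m : nat) (hn : (2 <= n)%N) (hm : (2 <= m)%N) (f : 'I_m -> {poly k})
    (partial : LND (surf n f)) (hpartial : is_surf_del partial) :
  let x := surf_pi n f (varX k) in
  ((forall b : surf n f,
      makar_limanov b <-> exists p : {poly k}, b = horner_alg x p)
   /\ semi_rigid (surf n f))
  /\ (forall D : LND (surf n f),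
        exists p : {poly k}, forall b, D b = horner_alg x p * partial b).
Proof.
move=> x; have m_gt0 : (0 < m)%N by apply: ltnW.
have [px py _] := hpartial.
have embed_partial b : embed (partial b) = coefK 'X^n * (embed b)^`().
  by apply: embed_lnd; rewrite ?rmorphXn /= ?constxX.
have lndE (D : LND (surf n f)) : exists p, forall b, D b = constx n f p * partial b.
  have [r Dr] := embed_lnd_ex m_gt0 hk hn hm D; exists r => b.
  have XnrE : coefK ('X^n * r) = coefK r * coefK 'X^n by rewrite mulrC rmorphM.
  apply: (embed_inj m_gt0).
  by rewrite Dr embed_constxM embed_partial XnrE mulrA.
have partial_const p : partial (constx n f p) = 0.
  by rewrite lnd_constx px mulr0.
have constx_eq0 p b : p != 0 -> (constx n f p * b == 0) = (b == 0).
  move=> p_neq0; rewrite -!(embed_eq0 m_gt0) embed_constxM mulf_eq0.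
  by rewrite polyC_eq0 tofrac_eq0 (negbTE p_neq0).
(* As [partial] kills p(x), the i-th iterate of [D] is p^i times that of [partial], and
   multiplication by a nonzero p^i is injective. Both therefore vanish at the same steps. *)
have degE (D : LND (surf n f)) a : lnd_nonzero D -> lnd_deg D a = lnd_deg partial a.
  have [p Dp] := lndE D; case=> b0 Db0.
  have p_neq0 : p != 0 by apply: contraNneq Db0 => p0; rewrite Dp p0 rmorph0 mul0r.
  have iterE i : iter i D a = constx n f (p ^+ i) * iter i partial a.
    elim: i => [|i IHi]; first by rewrite expr0 rmorph1 mul1r.
    rewrite !iterS IHi Dp lnd_leibniz partial_const mulr0 addr0 mulrA -rmorphM.
    by rewrite -exprS.
  rewrite /lnd_deg; case: ifP => // _; congr Some; apply: eq_ex_minn => i.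
  by rewrite iterE constx_eq0 ?expf_neq0.
split; [split=> [b|D1 D2 nz1 nz2 a]|exact: lndE].
  split=> [/(_ partial)pb|[p ->] D]; last first.
    by have [r ->] := lndE D; rewrite partial_const mulr0.
  (* The kernel of [partial] alone is already k[x]: its elements have zero y-derivative, hence
     y-degree 0. *)
  apply: (embed_constant m_gt0); apply: (deriv_eq0 hk); apply/eqP.
  have := embed_partial b; rewrite pb rmorph0 => /esym/eqP.
  by rewrite mulf_eq0 polyC_eq0 tofrac_eq0 expf_eq0 polyX_eq0 andbF.
by rewrite !degE.
Qed.
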